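(* For any $\alpha \in (\frac{\pi}{2}, \pi)$ there are constants $C, c > 1$ such that for all sufficiently large $d$ $$2^{c^{d}} < f(d, \alpha) < 2^{C^{d}}.$$
   Context: For a positive integer $d$ and a real number $\alpha$, $f(d,\alpha)$ denotes the size of the largest set of points in $\mathbb{R}^d$ with no three (distinct) points forming an angle at least $\alpha$; that is, the largest size of a set $X\subset\mathbb{R}^d$ such that for all distinct $x,y,z\in X$ the angle at $x$ between the vectors $y-x$ and $z-x$ is strictly less than $\alpha$. *)

(* Defs.v *)
From mathcomp Require Import all_boot all_order all_algebra.
From mathcomp Require Import all_classical all_reals all_analysis.
Import Order.TTheory GRing.Theory Num.Theory.
Import numFieldNormedType.Exports.

Set Implicit Arguments.
Unset Strict Implicit.
Unset Printing Implicit Defensive.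

Local Open Scope classical_set_scope.
Local Open Scope ring_scope.

Definition dotv (R : realType) (d : nat) (u v : 'rV[R]_d) : R :=
  \sum_(i < d) u ord0 i * v ord0 i.

(* The library norm `|u| on row vectors is the sup norm, hence this one. *)
Definition enorm (R : realType) (d : nat) (u : 'rV[R]_d) : R :=
  Num.sqrt (dotv u u).

(* The angle at the vertex x, in [0, pi]; meaningful when y != x and z != x. *)
Definition angle (R : realType) (d : nat) (x y z : 'rV[R]_d) : R :=
  acos (dotv (y - x) (z - x) / (enorm (y - x) * enorm (z - x))).

Definition angles_lt (R : realType) (d : nat) (alpha : R)
    (X : set 'rV[R]_d) : Prop :=
  forall x y z : 'rV[R]_d, X x -> X y -> X z ->
    x <> y -> x <> z -> y <> z -> angle x y z < alpha.

(* [counting X] is the cardinal of X, and +oo when X is infinite.  The supremum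
   is therefore a maximum as soon as it is finite, its elements being naturals
   or +oo. *)
Definition f (R : realType) (d : nat) (alpha : R) : \bar R :=
  ereal_sup [set counting X | X in [set X : set 'rV[R]_d | angles_lt alpha X]].

(* Main.v *)
(* Upper bound: cut the unit sphere into exponentially many cells of small
   diameter, and send a point x of X to the set of the cells containing the
   direction of some y - x, with y in X.  If x and y have the same image, the
   cell of y - x also contains some z - y, so that the angle at y between x and
   z is nearly pi.  Hence this map is injective, and X has at most
   2 ^ (number of cells) points.

   Lower bound (Erdos and Furedi): a random choice of signs gives exponentially
   many almost orthogonal vectors v_k in {-1, 1}^d.  For a small fixed lam, take
   the 2^K points p_S = \sum_(k in S) lam^k v_k.  The difference p_T - p_S has
   nearly the direction of +-v_i, where i is the first index at which S and T
   differ; two such directions at the same vertex S are nearly orthogonal, or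
   nearly equal, the sign being determined by S. *)
Require Import Defs.
From mathcomp Require Import all_boot all_order all_algebra.
From mathcomp Require Import all_classical all_reals all_analysis.
From mathcomp Require Import ring lra.
Import Order.TTheory GRing.Theory Num.Theory.
Import numFieldNormedType.Exports.
Set Implicit Arguments.
Unset Strict Implicit.
Unset Printing Implicit Defensive.
Local Open Scope classical_set_scope.
Local Open Scope ring_scope.

(** * Euclidean inner product and angles *)

Section InnerProduct.
Context {R : realType} {d : nat}.
Implicit Types u v w x y z : 'rV[R]_d.

Lemma dotvC u v : dotv u v = dotv v u.
Proof. by apply: eq_bigr => i _; rewrite mulrC. Qed.

Lemma dotvDl u v w : dotv (u + v) w = dotv u w + dotv v w.
Proof. by rewrite -big_split; apply: eq_bigr => i _; rewrite mxE mulrDl. Qed.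

Lemma dotvZl (a : R) u v : dotv (a *: u) v = a * dotv u v.
Proof. by rewrite /dotv mulr_sumr; apply: eq_bigr => i _; rewrite mxE mulrA. Qed.

Lemma dotvDr u v w : dotv u (v + w) = dotv u v + dotv u w.
Proof. by rewrite dotvC dotvDl !(dotvC u). Qed.

Lemma dotvZr (a : R) u v : dotv u (a *: v) = a * dotv u v.
Proof. by rewrite dotvC dotvZl dotvC. Qed.

Lemma dotv0r u : dotv u 0 = 0.
Proof. by rewrite -(scale0r 0) dotvZr mul0r. Qed.

Lemma dotvNl u v : dotv (- u) v = - dotv u v.
Proof. by rewrite -scaleN1r dotvZl mulN1r. Qed.

Lemma dotvNr u v : dotv u (- v) = - dotv u v.
Proof. by rewrite dotvC dotvNl dotvC. Qed.

Lemma dotv_sumr (I : finType) u (v : I -> 'rV[R]_d) :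
  dotv u (\sum_i v i) = \sum_i dotv u (v i).
Proof. by elim/big_rec2: _ => [|i a w _ <-]; rewrite ?dotvDr ?dotv0r. Qed.

Lemma dotv_suml (I : finType) (u : I -> 'rV[R]_d) v :
  dotv (\sum_i u i) v = \sum_i dotv (u i) v.
Proof. by rewrite dotvC dotv_sumr; apply: eq_bigr => i _; rewrite dotvC. Qed.

Lemma dotv_ge0 u : 0 <= dotv u u.
Proof. by apply: sumr_ge0 => i _; rewrite -expr2 sqr_ge0. Qed.

Lemma dotv_gt0 u : (0 < dotv u u) = (u != 0).
Proof.
rewrite lt_neqAle dotv_ge0 andbT eq_sym; congr negb.
apply/eqP/eqP => [u0|->]; last exact: dotv0r.
apply/rowP => i; rewrite mxE; apply/eqP; rewrite -sqrf_eq0 expr2; apply/eqP.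
by move/psumr_eq0P: u0; apply=> // j _; rewrite -expr2 sqr_ge0.
Qed.

Lemma enorm_gt0 u : (0 < enorm u) = (u != 0).
Proof. by rewrite sqrtr_gt0 dotv_gt0. Qed.

Lemma sqr_enorm u : enorm u ^+ 2 = dotv u u.
Proof. by rewrite sqr_sqrtr ?dotv_ge0. Qed.

Lemma CauchySchwarz_dotv u v : `|dotv u v| <= enorm u * enorm v.
Proof.
have [->|u0] := eqVneq u 0.
  by rewrite dotvC dotv0r normr0 mulr_ge0 ?sqrtr_ge0.
have u_gt0 : 0 < dotv u u by rewrite dotv_gt0.
rewrite -sqrtrM ?dotv_ge0// -[leLHS]sqrtr_sqr ler_wsqrtr//.
have := dotv_ge0 (dotv u u *: v - dotv u v *: u).
rewrite !(dotvDl, dotvDr, dotvNl, dotvNr, dotvZl, dotvZr) (dotvC v u).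
rewrite (_ : _ + _ =
  dotv u u * (dotv u u * dotv v v - dotv u v ^+ 2)); last by ring.
by rewrite pmulr_rge0// subr_ge0.
Qed.

(** Cauchy-Schwarz puts the quotient in [[-1, 1]], where [cos] undoes [acos], and [cos] is
    decreasing on [[0, pi]]. Angle conditions thus become inequalities between inner products. *)
Lemma angle_lt (alpha : R) x y z : 0 <= alpha <= pi -> x != y -> x != z ->
  (angle x y z < alpha) =
  (cos alpha * (enorm (y - x) * enorm (z - x)) < dotv (y - x) (z - x)).
Proof.
move=> alphaP xy xz; rewrite -ltr_pdivlMr; last first.
  by rewrite mulr_gt0// enorm_gt0 subr_eq0 eq_sym.
set q := _ / _; have q1 : -1 <= q <= 1.
  have e0 : 0 < enorm (y - x) * enorm (z - x).
    by rewrite mulr_gt0// enorm_gt0 subr_eq0 eq_sym.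
  rewrite -ler_norml /q normrM normfV (gtr0_norm e0) ler_pdivrMr// mul1r.
  exact: CauchySchwarz_dotv.
rewrite /angle -/q -[in RHS](@acosK _ q) ?in_itv//= ltr_cos//= in_itv/=.
by rewrite acos_ge0 ?acos_lepi.
Qed.

End InnerProduct.

(** Testing finite lists also rules out an infinite [X], since such a set contains [n.+1] distinct
    points. *)
Lemma counting_le (R : realType) (T : choiceType) (X : set T) (n : nat) :
  (forall s : seq T, uniq s -> (forall x, x \in s -> X x) -> (size s <= n)%N) ->
  (counting X <= n%:R%:E :> \bar R)%E.
Proof.
move=> Xn; rewrite /counting; case: asboolP => [finX|infX].
  rewrite lee_fin ler_nat Xn ?finmap.fset_uniq// => x.
  by rewrite in_fset_set// inE.
have [B BX] := infinite_set_fset n.+1 infX.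
by rewrite ltnNge Xn ?finmap.fset_uniq// => x /BX.
Qed.

Lemma counting_ge (R : realType) (T : choiceType) (X : set T) (s : seq T) :
  uniq s -> (forall x, x \in s -> X x) ->
  ((size s)%:R%:E <= counting X :> \bar R)%E.
Proof.
move=> us sX; rewrite /counting; case: asboolP => [finX|_]; last exact: leey.
rewrite lee_fin ler_nat uniq_leq_size// => x /sX.
by rewrite in_fset_set// inE.
Qed.

(** * Upper bound: cells of directions *)

Section UpperBound.
Context {R : realType}.

Definition cell_code (m d : nat) : Type :=
  (d.-tuple 'I_(m * d).+1 * {ffun 'I_d -> bool})%type.

(* A grid of mesh 1 / (m sqrt d).  The l1 norm of a unit vector is at most
   sqrt d, so the truncated coordinates sum to at most m * d: this is what makes the
   number of cells exponential in d, and not of order d ^ d. *)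
Definition cell (m d : nat) (u : 'rV[R]_d) : cell_code m d :=
  ([tuple inord (Num.truncn (m%:R * Num.sqrt d%:R * `|u ord0 i|)) | i < d],
   [ffun i => u ord0 i < 0]).

Definition cells (m d : nat) : {set cell_code m d} :=
  [set c : cell_code m d | (\sum_(i <- c.1) i <= m * d)%N]%SET.

(** The tuples are counted by the binomial coefficient of [d + m * d] over [d], a single term in the
    expansion of [(1 + 1) ^ (d + m * d)]. The sign patterns give the remaining factor [2 ^ d]. *)
Lemma card_cells (m d : nat) : (#|cells m d| <= 2 ^ (m.+2 * d))%N.
Proof.
have -> : cells m d =
    finset.setX [set t : d.-tuple 'I_(m * d).+1 | (\sum_(i <- t) i <= m * d)%N]%SET
      finset.setT.
  by apply/setP => c; rewrite !inE andbT.
rewrite cardsX card_partial_ord_partitions cardsT card_ffun card_bool card_ord.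
rewrite (_ : m.+2 * d = (d + m * d) + d)%N; last by rewrite !mulSn addnC.
rewrite expnD leq_mul2r; apply/orP; right.
rewrite -[X in (X <= _)%N]muln1 -[2%N]/(1 + 1)%N expnDn.
have dm : (d < (d + m * d).+1)%N by rewrite ltnS leq_addr.
by rewrite (bigD1 (Ordinal dm))//= !exp1n !muln1 leq_addr.
Qed.

Lemma sum_truncn_unit (m d : nat) (u : 'rV[R]_d) : dotv u u = 1 ->
  (\sum_(i < d) Num.truncn (m%:R * Num.sqrt d%:R * `|u ord0 i|) <= m * d)%N.
Proof.
move=> u1; rewrite -(ler_nat R) natr_sum.
(* By AM-GM, [sqrt d * |u_i| <= (1 + d * u_i ^ 2) / 2]; these bounds sum to [d] because [u] is a
   unit vector. *)
have trunc_le i : (Num.truncn (m%:R * Num.sqrt d%:R * `|u ord0 i|))%:R <=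
    m%:R / 2 * (1 + d%:R * (u ord0 i * u ord0 i)).
  rewrite (le_trans (y := m%:R * Num.sqrt d%:R * `|u ord0 i|))//.
    by rewrite truncn_le !mulr_ge0 ?sqrtr_ge0.
  rewrite -!mulrA ler_wpM2l// ler_pdivlMl// -expr2 -real_normK ?num_real//.
  rewrite -[X in _ + X * _](@sqr_sqrtr _ d%:R)// -exprMn.
  set t := _ * `|_|; have := sqr_ge0 (t - 1); lra.
apply: (le_trans (ler_sum _ (fun i _ => trunc_le i))).
rewrite -mulr_sumr big_split/= -mulr_sumr -/(dotv u u) u1 sumr_const card_ord.
by rewrite natrM mulr1 -(mulrA _ 2^-1) ler_wpM2l//; lra.
Qed.

Lemma cell_in (m d : nat) (u : 'rV[R]_d) : dotv u u = 1 -> cell m u \in cells m d.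
Proof.
move=> u1; have su := sum_truncn_unit m u1.
rewrite inE/= big_map big_enum/=; apply: leq_trans su.
(* Out of range, [inord] defaults to 0, so the inequality holds in that case too. *)
apply: leq_sum => i _; rewrite /inord /insubd; case: insubP => //= j _ -> //.
Qed.

(** Each coordinate of [u - v] is at most [1 / M] in absolute value, with [M = m * sqrt d]. Hence
    the squared distance, which is [2 - 2 * dotv u v], is at most [d / M ^ 2 = 1 / m ^ 2]. *)
Lemma dotv_same_cell (m d : nat) (u v : 'rV[R]_d) : (0 < m)%N ->
  dotv u u = 1 -> dotv v v = 1 -> cell m u = cell m v ->
  1 - (2 * m%:R ^+ 2)^-1 <= dotv u v.
Proof.
move=> m0 u1 v1 uv.
have d0 : (0 < d)%N.
  by case: d u v u1 v1 uv => // u v; rewrite /dotv big_ord0 => /eqP; rewrite eq_sym oner_eq0.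
pose M : R := m%:R * Num.sqrt d%:R.
have M2 : M ^+ 2 = m%:R ^+ 2 * d%:R by rewrite exprMn sqr_sqrtr.
have M_gt0 : 0 < M by rewrite mulr_gt0 ?sqrtr_gt0 ?ltr0n.
(* One term is at most the whole sum, so [inord] never falls back on its default and equal codes
   give equal truncations. *)
have trunc_lt (w : 'rV[R]_d) (i : 'I_d) : dotv w w = 1 ->
   (Num.truncn (M * `|w ord0 i|) < (m * d).+1)%N.
  move=> w1; rewrite ltnS (leq_trans _ (sum_truncn_unit m w1))//.
  by rewrite (bigD1 i)//= leq_addr.
have close i : (M * (u ord0 i - v ord0 i)) ^+ 2 <= 1.
  have : tnth (cell m u).1 i = tnth (cell m v).1 i by rewrite uv.
  rewrite !tnth_mktuple -/M => /(congr1 val); rewrite /= !inordK ?trunc_lt// => tuv.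
  have : (cell m u).2 i = (cell m v).2 i by rewrite uv.
  rewrite !ffunE => suv.
  have Mw (w : 'rV[R]_d) : 0 <= M * `|w ord0 i| by rewrite mulr_ge0// ltW.
  have := truncn_itv (Mw u); have := truncn_itv (Mw v); rewrite tuv -natr1.
  move: (Num.truncn _)%:R => t /andP[v_ge v_lt] /andP[u_ge u_lt].
  (* The recorded signs agree, so absolute values may replace the coordinates. *)
  have -> : (M * (u ord0 i - v ord0 i)) ^+ 2 = (M * `|u ord0 i| - M * `|v ord0 i|) ^+ 2.
    move: suv; case: ltrP => u0 /esym; case: ltrP => // v0 _.
      by rewrite !ltr0_norm// -mulrBr -opprD mulrN sqrrN.
    by rewrite !ger0_norm// -mulrBr.
  rewrite -real_normK ?num_real// expr_le1// ler_norml; lra.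
have : \sum_i (M * (u ord0 i - v ord0 i)) ^+ 2 <= d%:R.
  by rewrite (le_trans (ler_sum _ (fun i _ => close i)))// sumr_const card_ord.
have -> : \sum_i (M * (u ord0 i - v ord0 i)) ^+ 2 = M ^+ 2 * (2 - 2 * dotv u v).
  transitivity (M ^+ 2 * dotv (u - v) (u - v)).
    by rewrite mulr_sumr; apply: eq_bigr => i _; rewrite exprMn -expr2 !mxE.
  by rewrite !(dotvDl, dotvDr, dotvNl, dotvNr) u1 v1 (dotvC v); congr (_ * _); ring.
rewrite M2 -mulrA (mulrC d%:R) mulrA -ler_pdivlMr ?ltr0n// divff ?pnatr_eq0 -?lt0n//.
move=> H; rewrite invfM lerBlDr -lerBlDl.
rewrite -[leRHS]mul1r mulrA ler_pdivlMr ?exprn_gt0 ?ltr0n//.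
lra.
Qed.

Definition dir (d : nat) (x y : 'rV[R]_d) : 'rV[R]_d :=
  (enorm (y - x))^-1 *: (y - x).

Lemma dir_unit (d : nat) (x y : 'rV[R]_d) : x != y -> dotv (dir x y) (dir x y) = 1.
Proof.
move=> xy; rewrite dotvZl dotvZr -sqr_enorm.
have : enorm (y - x) != 0 by rewrite gt_eqF// enorm_gt0 subr_eq0 eq_sym.
by move=> ?; rewrite expr2 mulKf ?mulVf.
Qed.

Lemma angle_dir_lt (alpha : R) (d : nat) (x y z : 'rV[R]_d) :
  0 <= alpha <= pi -> x != y -> x != z ->
  (angle x y z < alpha) = (cos alpha < dotv (dir x y) (dir x z)).
Proof.
move=> alphaP xy xz; rewrite angle_lt// dotvZl dotvZr.
have nxy : 0 < enorm (y - x) by rewrite enorm_gt0 subr_eq0 eq_sym.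
have nxz : 0 < enorm (z - x) by rewrite enorm_gt0 subr_eq0 eq_sym.
by rewrite [in RHS]mulrA -invfM ltr_pdivlMl ?mulr_gt0// mulrC.
Qed.

Lemma dirC (d : nat) (x y : 'rV[R]_d) : dir y x = - dir x y.
Proof.
rewrite /dir -(opprB y x) scalerN; congr (- (_^-1 *: _)).
by rewrite /enorm dotvNl dotvNr opprK.
Qed.

Lemma size_angles_lt (alpha : R) (m d : nat) (X : set 'rV[R]_d) (s : seq 'rV[R]_d) :
  0 <= alpha <= pi -> (0 < m)%N -> (2 * m%:R ^+ 2)^-1 <= 1 + cos alpha ->
  angles_lt alpha X -> uniq s -> (forall x, x \in s -> X x) ->
  (size s <= 2 ^ 2 ^ (m.+2 * d))%N.
Proof.
move=> alphaP m0 mP Xlt us sX.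
pose S x := [set c in [seq cell m (dir x y) | y <- s & y != x]]%SET.
have S_inj : {in s &, injective S}.
  move=> x y xs ys Sxy; apply: contraTeq isT => xy.
  have : cell m (dir x y) \in S x.
    by rewrite inE; apply/mapP; exists y => //; rewrite mem_filter eq_sym xy.
  rewrite Sxy inE => /mapP[z]; rewrite mem_filter => /andP[zy zs] same.
  have := dotv_same_cell m0 (dir_unit xy) _ same.
  rewrite dir_unit 1?eq_sym// => /(_ erefl).
  (* If [z = x], a unit vector and its opposite share a cell, which forces
     [1 - 1 / (2 * m ^ 2) <= -1]. *)
  have [->|zx] := eqVneq z x.
    rewrite (dirC x y) dotvNr dir_unit//.
    have m1 : (1 : R) <= m%:R ^+ 2 by rewrite -natrX ler1n expn_gt0 m0.
    have : (2 * m%:R ^+ 2)^-1 <= 1 :> R by rewrite invf_le1; lra.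
    by lra.
  (* Otherwise [dir y z] is close to [- dir y x], and their closeness contradicts the angle bound at
     [y]. *)
  have := Xlt y x z (sX _ ys) (sX _ xs) (sX _ zs).
  move=> /(_ (nesym (elimN eqP xy)) (nesym (elimN eqP zy)) (nesym (elimN eqP zx))).
  rewrite angle_dir_lt 1?eq_sym// (dirC x y) dotvNl => H1 H2.
  by lra.
rewrite -(size_map S) -(card_uniqP _); last by rewrite map_inj_in_uniq.
apply: leq_trans (_ : #|powerset (cells m d)| <= _)%N; last first.
  by rewrite card_powerset leq_exp2l// card_cells.
apply/subset_leq_card/fintype.subsetP => _ /mapP[x xs ->].
rewrite powersetE; apply/fintype.subsetP => c.
rewrite inE => /mapP[y]; rewrite mem_filter => /andP[yx _] ->.
by rewrite cell_in// dir_unit// eq_sym.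
Qed.

Lemma f_lt_double_exp (alpha : R) : pi / 2 < alpha < pi ->
  exists2 C : R, 1 < C &
    forall d, (0 < d)%N -> (f d alpha < (2 `^ (C ^+ d))%:E)%E.
Proof.
move=> /andP[alpha1 alpha2].
have pi0 : 0 < pi :> R := pi_gt0 R.
have alphaP : 0 <= alpha <= pi by apply/andP; split; lra.
have cos_gt : 0 < 1 + cos alpha.
  rewrite -ltrBlDl sub0r -cospi ltr_cos// in_itv/= ?lexx ?ltW//.
(* Any integer [m > 1 / (1 + cos alpha)] will do, since [2 * m ^ 2 >= m]. *)
pose m := (Num.truncn ((1 + cos alpha)^-1)).+1.
have mP : (2 * m%:R ^+ 2)^-1 <= 1 + cos alpha.
  have m_gt : (1 + cos alpha)^-1 < m%:R by exact: truncnS_gt.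
  have m1 : (1 : R) <= m%:R by rewrite ler1n.
  rewrite invf_ple ?posrE//; last by rewrite mulr_gt0// exprn_gt0// ltr0n.
  rewrite (le_trans (ltW m_gt))// expr2; nra.
(* The exponent [m.+3], one more than in the bound on the size, makes the inequality strict for
   [d > 0]. *)
exists (2 ^+ m.+3); first by rewrite -natrX ltr1n -(expn0 2) ltn_exp2l.
move=> d d0; apply: (@le_lt_trans _ _ (2 ^ 2 ^ (m.+2 * d))%:R%:E); last first.
  rewrite lte_fin -exprM -natrX powR_mulrn// natrX ltr_eXn2l ?ltr1n//.
  by rewrite ltn_exp2l// ltn_mul2r d0/=.
apply: ge_ereal_sup => _ [X Xlt <-]; apply: counting_le => s us sX.
exact: size_angles_lt alphaP _ mP Xlt us sX.
Qed.

End UpperBound.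

(** * Lower bound: binary sums along almost orthogonal directions *)

Section LowerBound.
Context {R : realType}.

(** Multiplying by [1 - lam] telescopes the tail to [lam ^ i - lam ^ K]. *)
Lemma geometric_tail_le (lam : R) (K i : nat) : 0 <= lam ->
  (1 - lam) * (\sum_(k < K) if (i <= k)%N then lam ^+ k else 0) <= lam ^+ i.
Proof.
move=> lam0.
suff -> : (1 - lam) * (\sum_(k < K) if (i <= k)%N then lam ^+ k else 0) =
    if (i <= K)%N then lam ^+ i - lam ^+ K else 0.
  by case: ifP => _; rewrite ?exprn_ge0// gerBl exprn_ge0.
elim: K => [|K IH].
  by rewrite big_ord0 mulr0; case: ifP => //; rewrite leqn0 => /eqP ->; rewrite subrr.
rewrite big_ord_recr/= mulrDr IH; have [iK|Ki] := leqP i K.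
  by rewrite (leqW iK) exprS; ring.
rewrite mulr0 addr0; case: ifP => // iK1.
by rewrite (@anti_leq i K.+1) ?subrr// iK1.
Qed.

(** Expand the product over pairs of indices. The absolute coefficients sum to at most
    [lam ^ (i + j) / (1 - lam) ^ 2], hence to at most [(1 + theta) * lam ^ (i + j)]. The pair
    [(i, j)] uses exactly [lam ^ (i + j)] of this, which leaves [theta] for the error. *)
Lemma dotv_leading_term (d K : nat) (D lam theta : R) (v : 'I_K -> 'rV[R]_d)
    (e e' : 'I_K -> R) (i j : 'I_K) :
  0 < lam < 1 -> 1 <= (1 - lam) ^+ 2 * (1 + theta) -> 0 <= D ->
  (forall k l, `|dotv (v k) (v l)| <= D) ->
  (forall k, `|e k| <= (i <= k)%N%:R) -> `|e i| = 1 ->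
  (forall k, `|e' k| <= (j <= k)%N%:R) -> `|e' j| = 1 ->
  `|dotv (\sum_k (e k * lam ^+ k) *: v k) (\sum_k (e' k * lam ^+ k) *: v k)
    - e i * e' j * dotv (v i) (v j) * lam ^+ (i + j)| <= D * theta * lam ^+ (i + j).
Proof.
move=> /andP[lam0 lam1] thetaP D0 vD eP ei e'P e'j.
have lam_ge0 n : 0 <= lam ^+ n by rewrite exprn_ge0// ltW.
have lam1_ge0 : 0 <= 1 - lam by rewrite subr_ge0 ltW.
have tail (h : 'I_K -> R) (n : 'I_K) : (forall k, `|h k| <= (n <= k)%N%:R) ->
    (1 - lam) * (\sum_k `|h k * lam ^+ k|) <= lam ^+ n.
  move=> hP; apply: le_trans (geometric_tail_le K n (ltW lam0)).
  rewrite ler_wpM2l//; apply: ler_sum => k _.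
  rewrite normrM (ger0_norm (lam_ge0 _)).
  have := hP k; case: (n <= k)%N => /= hk; last first.
    by rewrite (le_anti (introT andP (conj hk (normr_ge0 _)))) mul0r.
  by rewrite ler_piMl.
have := tail _ _ eP; have := tail _ _ e'P.
set Y := \sum_k `|e' k * _|; set X := \sum_k `|e k * _| => Yj Xi.
have XY : X * Y <= (1 + theta) * lam ^+ (i + j).
  rewrite -(ler_pM2l (_ : 0 < (1 - lam) ^+ 2)) ?exprn_gt0 ?subr_gt0//.
  apply: (@le_trans _ _ (lam ^+ (i + j))); last first.
    by rewrite mulrA ler_peMl.
  by rewrite exprD expr2 mulrACA ler_pM// mulr_ge0 ?sumr_ge0.
rewrite dotv_suml; under eq_bigr do rewrite dotv_sumr.
rewrite pair_bigA/= (bigD1 (i, j))//= dotvZl dotvZr exprD.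
rewrite [X in `|X|](_ : _ = \sum_(p | p != (i, j))
   dotv ((e p.1 * lam ^+ p.1) *: v p.1) ((e' p.2 * lam ^+ p.2) *: v p.2)); last by ring.
apply: le_trans (ler_norm_sum _ _ _) _.
apply: (@le_trans _ _ (\sum_(p | p != (i, j))
   `|e p.1 * lam ^+ p.1| * `|e' p.2 * lam ^+ p.2| * D)).
  apply: ler_sum => p _; rewrite dotvZl dotvZr !normrM mulrA.
  by rewrite ler_wpM2l ?mulr_ge0.
rewrite -mulr_suml mulrC -mulrA ler_wpM2l//.
have : X * Y = `|e i * lam ^+ i| * `|e' j * lam ^+ j| +
    \sum_(p | p != (i, j)) `|e p.1 * lam ^+ p.1| * `|e' p.2 * lam ^+ p.2|.
  rewrite /X mulr_suml; under eq_bigr do rewrite mulr_sumr.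
  by rewrite pair_bigA/= (bigD1 (i, j)).
rewrite !normrM ei e'j !mul1r !ger0_norm// -exprD => XYE.
by move: XY; rewrite XYE mulrDl mul1r lerD2l exprD.
Qed.

(* {ffun 'I_K -> bool} encodes the subsets of 'I_K. *)
Definition binary_point (d K : nat) (lam : R) (v : 'I_K -> 'rV[R]_d)
    (S : {ffun 'I_K -> bool}) : 'rV[R]_d :=
  \sum_k ((S k)%:R * lam ^+ k) *: v k.

Lemma first_difference (K : nat) (S T : {ffun 'I_K -> bool}) : S != T ->
  exists2 i, S i != T i & forall k : 'I_K, (k < i)%N -> S k = T k.
Proof.
move=> ST; have [i0 Hi0] : exists i, S i != T i.
  apply/existsP; apply: contraR ST; rewrite negb_exists => /forallP ST.
  by apply/eqP/ffunP => i; apply/eqP; have := ST i; rewrite negbK.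
case: (@arg_minnP _ i0 (fun i => S i != T i) val Hi0) => i Hi imin.
exists i => // k ki; apply/eqP; apply: contraTT ki => Hk.
by rewrite -leqNgt imin.
Qed.

Lemma binary_point_diff (d K : nat) (lam : R) (v : 'I_K -> 'rV[R]_d)
    (S T : {ffun 'I_K -> bool}) :
  binary_point lam v T - binary_point lam v S =
  \sum_k (((T k)%:R - (S k)%:R) * lam ^+ k) *: v k.
Proof.
by rewrite -sumrB; apply: eq_bigr => k _; rewrite mulrBl scalerBl.
Qed.

Lemma normr_bool_sub (b c : bool) : `|b%:R - c%:R| = (b != c)%:R :> R.
Proof.
by case: b; case: c; rewrite /= ?subrr ?subr0 ?sub0r ?normrN ?normr0 ?normr1.
Qed.

(** The leading terms, at the first differences [i] and [j], control everything: the norms are at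
    least [g * lam ^ i] and [g * lam ^ j] with [g ^ 2 = D * (1 - theta)], and the inner product is
    known up to [D * theta * lam ^ (i + j)]. *)
Lemma binary_point_angle (d K : nat) (D lam theta eta kappa : R)
    (v : 'I_K -> 'rV[R]_d) (S T U : {ffun 'I_K -> bool}) :
  let a := binary_point lam v T - binary_point lam v S in
  let b := binary_point lam v U - binary_point lam v S in
  0 < lam < 1 -> 1 <= (1 - lam) ^+ 2 * (1 + theta) -> theta < 1 -> 0 < D -> 0 < kappa ->
  eta + theta < kappa * (1 - theta) ->
  (forall k, dotv (v k) (v k) = D) ->
  (forall k l, k != l -> `|dotv (v k) (v l)| <= eta * D) ->
  (forall k l, `|dotv (v k) (v l)| <= D) ->
  S != T -> S != U ->
  [/\ 0 < enorm a, 0 < enorm b & - kappa * (enorm a * enorm b) < dotv a b].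
Proof.
move=> a b lamP thetaP theta1 D0 kappa0 etaP vv vlD vD.
have lam0 : 0 < lam by case/andP: lamP.
move=> /first_difference[i STi STlt] /first_difference[j SUj SUlt].
pose e k : R := (T k)%:R - (S k)%:R; pose e' k : R := (U k)%:R - (S k)%:R.
have eP k : `|e k| <= (i <= k)%N%:R.
  rewrite /e; have [ik|/STlt->] := leqP i k; last by rewrite subrr normr0.
  by rewrite normr_bool_sub ler_nat leq_b1.
have e'P k : `|e' k| <= (j <= k)%N%:R.
  rewrite /e'; have [jk|/SUlt->] := leqP j k; last by rewrite subrr normr0.
  by rewrite normr_bool_sub ler_nat leq_b1.
have ei : `|e i| = 1 by rewrite normr_bool_sub eq_sym STi.
have e'j : `|e' j| = 1 by rewrite normr_bool_sub eq_sym SUj.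
pose g := Num.sqrt (D * (1 - theta)).
have g2 : g ^+ 2 = D * (1 - theta) by rewrite sqr_sqrtr// mulr_ge0 ?subr_ge0// ltW.
have g0 : 0 < g by rewrite sqrtr_gt0 mulr_gt0 ?subr_gt0.
have gl n : 0 < g * lam ^+ n by rewrite mulr_gt0// exprn_gt0.
have lead := dotv_leading_term lamP thetaP (ltW D0) vD.
have leading_ge (h : 'I_K -> R) (n : 'I_K) : (forall k, `|h k| <= (n <= k)%N%:R) -> `|h n| = 1 ->
    g * lam ^+ n <= enorm (\sum_k (h k * lam ^+ k) *: v k).
  move=> hP hn; have := lead _ _ _ _ hP hn hP hn.
  rewrite vv -expr2 -real_normK ?num_real// hn expr1n mul1r ler_distl => /andP[H _].
  rewrite -(@ler_pXn2r _ 2)// ?nnegrE ?sqrtr_ge0 ?(ltW (gl n))//.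
  rewrite sqr_enorm exprMn g2 -exprM muln2 -addnn; apply: le_trans H.
  by rewrite le_eqVlt; apply/orP; left; apply/eqP; ring.
have aE : a = \sum_k (e k * lam ^+ k) *: v k := binary_point_diff _ _ _ _.
have bE : b = \sum_k (e' k * lam ^+ k) *: v k := binary_point_diff _ _ _ _.
have na := leading_ge _ _ eP ei; have nb := leading_ge _ _ e'P e'j.
rewrite -aE in na; rewrite -bE in nb.
have a0 := lt_le_trans (gl _) na; have b0 := lt_le_trans (gl _) nb.
split => //; have := lead _ _ _ _ eP ei e'P e'j; rewrite -aE -bE ler_distl => /andP[+ _].
have L0 : 0 < lam ^+ (i + j) by rewrite exprn_gt0.
(* At a common first difference, [T] and [U] both take the value opposite to that of [S]; the
   leading signs agree and the inner product is positive. *)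
have [ij|ij] := eqVneq i j.
  have -> : e i * e' j = 1.
    by rewrite /e /e' -ij; move: STi SUj; rewrite -ij;
      case: (T i); case: (U i); case: (S i) => //= _ _; ring.
  rewrite ij vv mul1r -ij -mulrBl => H.
  apply: lt_le_trans H; apply: (@lt_trans _ _ 0).
    by rewrite mulNr oppr_lt0 !mulr_gt0.
  by rewrite mulr_gt0 ?exprn_gt0// subr_gt0 gtr_pMr.
(* For [i != j], the inner product is at least [- (eta + theta) * D * lam ^ (i + j)], to be compared
   with the lower bound on the norms. *)
move=> H; apply: lt_le_trans H.
have nab : D * (1 - theta) * lam ^+ (i + j) <= enorm a * enorm b.
  rewrite -g2 exprD expr2 mulrACA ler_pM//; exact: ltW.
apply: (@le_lt_trans _ _ (- kappa * (D * (1 - theta) * lam ^+ (i + j)))).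
  by rewrite !mulNr lerN2 ler_pM2l.
have : `|e i * e' j * dotv (v i) (v j)| <= eta * D.
  by rewrite !normrM ei e'j !mul1r vlD.
rewrite ler_norml => /andP[+ _]; set G := _ * dotv _ _ => GD.
rewrite -mulrBl mulrA ltr_pM2r//; nra.
Qed.


(** * Exponentially many almost orthogonal sign vectors *)

Definition sign_vector (d : nat) (w : {ffun 'I_d -> bool}) : 'rV[R]_d :=
  \row_i (-1) ^+ w i.

Lemma dotv_sign_vector (d : nat) (w : {ffun 'I_d -> bool}) :
  dotv (sign_vector w) (sign_vector w) = d%:R.
Proof.
rewrite -[in RHS](card_ord d) -sum1_card natr_sum; apply: eq_bigr => i _.
by rewrite !mxE -signr_addb addbb.
Qed.

Lemma dotv_sign_vector_le (d : nat) (w w' : {ffun 'I_d -> bool}) :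
  `|dotv (sign_vector w) (sign_vector w')| <= d%:R.
Proof.
rewrite (le_trans (CauchySchwarz_dotv _ _))//.
by rewrite /enorm !dotv_sign_vector -expr2 sqr_sqrtr.
Qed.

(** The moment generating function factors over the coordinates; the sign of [a] at a coordinate
    only swaps the two exponentials. *)
Lemma sum_expR_dotv_sign (d : nat) (s : R) (a : {ffun 'I_d -> bool}) :
  \sum_w expR (s * dotv (sign_vector a) (sign_vector w)) = (expR s + expR (- s)) ^+ d.
Proof.
pose F (i : 'I_d) (b : bool) := expR (s * (sign_vector a ord0 i * (-1) ^+ b)).
transitivity (\sum_(w : {ffun 'I_d -> bool}) \prod_i F i (w i)).
  apply: eq_bigr => w _; rewrite mulr_sumr expR_sum.
  by apply: eq_bigr => i _; rewrite /F !mxE.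
rewrite -bigA_distr_bigA -[in RHS](card_ord d) -prodr_const; apply: eq_bigr => i _.
rewrite big_bool /F /= mxE.
by case: (a i); rewrite /= ?mulN1r ?mul1r ?opprK ?mulr1 ?mulrN1// addrC.
Qed.

Definition far (d : nat) (eta : R) (a : {ffun 'I_d -> bool}) :=
  [set w : {ffun 'I_d -> bool} |
    eta * d%:R < `|dotv (sign_vector a) (sign_vector w)|]%SET.

(* The Chernoff rate: cosh s <= 1 / (1 - s ^ 2) and 1 + 2 s ^ 2 <= expR (eta s)
   for s = eta / 2. *)
Lemma cosh_rate (eta : R) : 0 < eta < 1 ->
  exists s c : R, [/\ 0 < s, 1 < c & (expR s + expR (- s)) * c <= 2 * expR (eta * s)].
Proof.
move=> /andP[eta0 eta1]; pose s := eta / 2.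
have s0 : 0 < s by rewrite /s; lra.
have s1 : s < 1 / 2 by rewrite /s; lra.
exists s, ((1 - s ^+ 2) * (1 + 2 * s ^+ 2)); split => //.
  have q0 : 0 < s ^+ 2 by rewrite exprn_gt0.
  have q1 : s ^+ 2 < 1 / 2 by rewrite expr2; nra.
  by nra.
have Es : expR s * (1 - s) <= 1.
  have := expR_ge1Dx (- s); rewrite expRN => H.
  by rewrite -ler_pdivlMl ?expR_gt0// mulr1.
have ENs : expR (- s) * (1 + s) <= 1.
  have := expR_ge1Dx s => H.
  by rewrite expRN -ler_pdivlMl ?invr_gt0 ?expR_gt0// invrK mulr1.
have Eeta : 1 + 2 * s ^+ 2 <= expR (eta * s).
  have := expR_ge1Dx (eta * s); rewrite /s expr2; lra.
rewrite mulrA; apply: (@le_trans _ _ (2 * (1 + 2 * s ^+ 2))); last by rewrite ler_pM2l.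
rewrite ler_pM2r; last by have := sqr_ge0 s; lra.
have -> : (expR s + expR (- s)) * (1 - s ^+ 2) =
  expR s * (1 - s) * (1 + s) + expR (- s) * (1 + s) * (1 - s) by ring.
nra.
Qed.

(** Chernoff bound: on [far eta a], the sum of the exponentials for [s] and [- s] exceeds [E ^ d],
    so both tails are handled at once. *)
Lemma card_far (d : nat) (eta s c : R) (a : {ffun 'I_d -> bool}) :
  0 < s -> 0 < c -> (expR s + expR (- s)) * c <= 2 * expR (eta * s) ->
  #|far eta a|%:R * c ^+ d <= 2 * 2 ^+ d.
Proof.
move=> s0 c0 cP; set E := expR (eta * s) in cP.
have E0 : 0 < E by exact: expR_gt0.
have : #|far eta a|%:R * E ^+ d <= 2 * (expR s + expR (- s)) ^+ d.
  rewrite -sum1_card natr_sum mulr_suml [2 * _]mulr_natl [_ *+ 2]mulr2n.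
  have := sum_expR_dotv_sign (- s) a; rewrite opprK addrC => moment_neg.
  rewrite -{1}(sum_expR_dotv_sign s a) -moment_neg.
  rewrite -big_split/= [leRHS](bigID (mem (far eta a)))/=.
  apply: (@le_trans _ _ (\sum_(w in far eta a) (expR (s * dotv (sign_vector a) (sign_vector w))
     + expR (- s * dotv (sign_vector a) (sign_vector w))))).
    apply: ler_sum => w; rewrite inE mul1r mulNr -expRM_natl mulr_natl => H.
    set t := dotv _ _ in H *.
    apply: (@le_trans _ _ (expR (s * `|t|))).
      by rewrite ler_expR -mulr_natr; nra.
    have := expR_gt0 (s * t); have := expR_gt0 (- (s * t)).
    by case: (ler0P t) => _; rewrite ?mulrN; lra.
  by rewrite lerDl sumr_ge0// => w _; rewrite addr_ge0 ?expR_ge0.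
move=> H; rewrite -(ler_pM2r (_ : 0 < E ^+ d)) ?exprn_gt0//.
rewrite mulrAC; apply: (@le_trans _ _ (2 * (expR s + expR (- s)) ^+ d * c ^+ d)).
  by rewrite ler_pM2r ?exprn_gt0.
rewrite -!mulrA ler_pM2l// -!exprMn lerXn2r// nnegrE ?mulr_ge0 ?addr_ge0 ?expR_ge0//; exact: ltW.
Qed.

Lemma sign_code (eta : R) : 0 < eta < 1 ->
  exists2 c : R, 1 < c & forall d : nat, (0 < d)%N ->
  exists2 A : {set {ffun 'I_d -> bool}},
    {in A &, forall a b, a != b ->
      `|dotv (sign_vector a) (sign_vector b)| <= eta * d%:R} &
    c ^+ d <= 2 * #|A|%:R.
Proof.
move=> etaP; have [s [c [s0 c1 cP]]] := cosh_rate etaP; exists c => // d d0.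
have c0 : 0 < c by exact: lt_trans c1.
have /andP[eta0 eta1] := etaP.
pose P (A : {set {ffun 'I_d -> bool}}) := [forall a in A, forall b in A,
  (a != b) ==> (`|dotv (sign_vector a) (sign_vector b)| <= eta * d%:R)].
have P0 : P finset.set0 by apply/forall_inP => a; rewrite inE.
(* Gilbert-Varshamov: the sets far eta a cover the cube when A is maximal. *)
have [A /maxsetP[PA Amax] _] := maxset_exists P0.
have PAE : {in A &, forall a b, a != b -> `|dotv (sign_vector a) (sign_vector b)| <= eta * d%:R}.
  by move=> a b aA bA; move/forall_inP/(_ a aA)/forall_inP/(_ b bA)/implyP: PA.
exists A => //.
have cover w : exists2 a, a \in A & w \in far eta a.
  have [wA|wA] := boolP (w \in A).
    (* A vector of [A] is far from itself in this sense: its self-product is [d > eta * d]. *)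
    exists w => //; rewrite inE dotv_sign_vector ger0_norm//.
    by rewrite gtr_pMl// ltr0n.
  apply/exists_inP; apply: contraR wA; rewrite negb_exists_in => /forall_inP farA.
  have wfar a : a \in A -> `|dotv (sign_vector a) (sign_vector w)| <= eta * d%:R.
    by move=> /farA; rewrite inE -leNgt.
  rewrite -(Amax (w |: A)%SET) ?setU11 ?subsetU1//.
  apply/forall_inP => a; rewrite !inE => /orP[/eqP->|aA];
    apply/forall_inP => b; rewrite !inE => /orP[/eqP->|bA]; apply/implyP.
  - by rewrite eqxx.
  - by rewrite dotvC wfar.
  - by rewrite wfar.
  - exact: PAE.
(* Count the cube through the cover: each [w] lies in at least one [far eta a]. *)
have H : (2 : R) ^+ d <= \sum_(a in A) #|far eta a|%:R.
  rewrite -natr_sum -natrX ler_nat.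
  have -> : (2 ^ d = #|{: {ffun 'I_d -> bool}}|)%N by rewrite card_ffun card_bool card_ord.
  under eq_bigr do rewrite -sum1_card big_mkcond.
  rewrite -sum1_card exchange_big; apply: leq_sum => w _ /=.
  by have [a aA wa] := cover w; rewrite (bigD1 a)//= wa.
have : 2 ^+ d * c ^+ d <= #|A|%:R * (2 * 2 ^+ d).
  apply: (@le_trans _ _ ((\sum_(a in A) #|far eta a|%:R) * c ^+ d)).
    by rewrite ler_pM2r ?exprn_gt0.
  rewrite mulr_suml mulr_natl -sumr_const; apply: ler_sum => a _.
  exact: card_far s0 c0 cP.
by rewrite mulrA mulrC (mulrC #|A|%:R) ler_pM2r ?exprn_gt0.
Qed.

(** * Choice of constants and conclusion *)

Lemma double_exp_lt_f (alpha : R) : pi / 2 < alpha < pi ->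
  exists2 c : R, 1 < c &
    forall d, (c - 1)^-1 < d%:R -> ((2 `^ (c ^+ d))%:E < f d alpha)%E.
Proof.
move=> /andP[alpha1 alpha2].
have pi0 : 0 < pi :> R := pi_gt0 R.
have alphaP : 0 <= alpha <= pi by apply/andP; split; lra.
have cos_lt : cos alpha < 0.
  by rewrite -cos_pihalf ltr_cos// in_itv/=; lra.
pose kappa := - cos alpha.
have kappa1 : kappa <= 1 by rewrite lerNl cos_geN1.
have kappa0 : 0 < kappa by rewrite oppr_gt0.
have etaP : 0 < kappa / 4 < 1 by lra.
have [c c1 codeP] := sign_code etaP.
have c0 : 0 < c by exact: lt_trans c1.
(* The square root absorbs the factor 2: [c' ^ d * c' ^ d <= 2 * #|A|] gives [c' ^ d < #|A|] once
   [c' ^ d > 2], which Bernoulli's inequality ensures for [d > 1 / (c' - 1)]. *)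
pose c' := Num.sqrt c.
have c'2 : c' ^+ 2 = c by rewrite sqr_sqrtr// ltW.
have c'1 : 1 < c' by rewrite -[1]sqrtr1 ltr_sqrt.
exists c' => // d dP.
have d0 : (0 < d)%N.
  by rewrite -(ltr0n R) (lt_trans _ dP)// invr_gt0 subr_gt0.
have [A A_far cA] := codeP d d0.
have c'A : c' ^+ d < #|A|%:R.
  have bernoulli n : 1 + n%:R * (c' - 1) <= c' ^+ n.
    elim: n => [|n IH]; first by rewrite mul0r addr0.
    rewrite exprS -natr1; have n0 : 0 <= n%:R * (c' - 1) ^+ 2 by rewrite mulr_ge0 ?sqr_ge0.
    apply: (@le_trans _ _ (c' * (1 + n%:R * (c' - 1)))).
      by lra.
    by rewrite ler_pM2l// (lt_trans _ c'1).
  have c'd : 2 < c' ^+ d.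
    apply: lt_le_trans (bernoulli d).
    by move: dP; rewrite -[ltLHS]mul1r ltr_pdivrMr ?subr_gt0//; lra.
  move: cA; rewrite -c'2 -exprM mulnC exprM expr2.
  have : 0 < c' ^+ d by lra.
  by nra.
pose v (k : 'I_#|A|) : 'rV[R]_d := sign_vector (enum_val k).
(* With [lam = kappa / 16] and [theta = eta = kappa / 4], the bound [kappa <= 1] yields both
   [(1 - lam) ^ 2 * (1 + theta) >= 1] and [eta + theta = kappa / 2 < kappa * (1 - theta)]. *)
pose p := @binary_point d #|A| (kappa / 16) v.
have pP S T U : S != T -> S != U -> [/\ 0 < enorm (p T - p S), 0 < enorm (p U - p S) &
    - kappa * (enorm (p T - p S) * enorm (p U - p S)) < dotv (p T - p S) (p U - p S)].
  move=> ST SU; apply: (@binary_point_angle d #|A| d%:R _ (kappa / 4) (kappa / 4)) => //.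
  - by lra.
  - by rewrite expr2; nra.
  - by lra.
  - by rewrite ltr0n.
  - by nra.
  - by move=> k; exact: dotv_sign_vector.
  - move=> k l kl; apply: A_far; rewrite ?enum_valP//.
    by apply: contra_neq kl => /enum_val_inj.
  - by move=> k l; exact: dotv_sign_vector_le.
have p_inj : injective p.
  move=> S T pST; apply/eqP; apply: contraT => ST.
  (* Taking [U = T], positivity of the norm separates the points. *)
  by have [+ _ _] := pP S T T ST ST; rewrite enorm_gt0 pST subrr eqxx.
pose s := codom p.
have s_lt : angles_lt alpha [set x | x \in s].
  move=> _ _ _ /codomP[S ->] /codomP[T ->] /codomP[U ->] /eqP + /eqP + _.
  rewrite !(inj_eq p_inj) => ST SU; rewrite angle_lt ?(inj_eq p_inj)//.
  by have [_ _] := pP _ _ _ ST SU; rewrite opprK.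
apply: (@lt_le_trans _ _ (size s)%:R%:E); last first.
  apply: le_trans (ereal_sup_ubound _); last by exists [set x | x \in s].
  by apply: counting_ge => //; rewrite map_inj_uniq ?enum_uniq.
rewrite size_codom card_ffun card_bool card_ord natrX -[2 ^+ _]powR_mulrn// lte_fin.
by rewrite /powR !pnatr_eq0/= ltr_expR ltr_pM2r ?ln_gt0 ?ltr1n.
Qed.

End LowerBound.

Unset Implicit Arguments.

Theorem proposition1 (R : realType) (alpha : R)
    (halpha : pi / 2 < alpha < pi) :
  exists C c : R, 1 < C /\ 1 < c /\
    \forall d \near \oo,
      ((2 `^ (c ^+ d))%:E < f d alpha)%E /\
      (f d alpha < (2 `^ (C ^+ d))%:E)%E.
Proof.
have [C C1 CP] := f_lt_double_exp halpha.
have [c c1 cP] := double_exp_lt_f halpha.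
exists C, c; split => //; split => //.
near=> d; split.
  apply: cP; near: d; exact: nbhs_infty_gtr.
apply: CP; near: d; exact: nbhs_infty_gt.
Unshelve. all: by end_near. Qed.
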